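(* Let $X$ be a finite ordered set of letters and let $(B(X),\circ)$ be the loop constructed in the context. The nuclei (the left nucleus, the middle nucleus, the right nucleus and the nucleus) and the center of $B(X)$ are trivial, i.e. equal to $\{1\}$.
   Context: Loops: for a loop $L$, $N_\lambda(L)=\{a\in L\mid a(xy)=(ax)y\ \forall x,y\in L\}$, $N_\mu(L)=\{a\in L\mid x(ay)=(xa)y\ \forall x,y\in L\}$, $N_\rho(L)=\{a\in L\mid x(ya)=(xy)a\ \forall x,y\in L\}$ are the left, middle and right nuclei; the nucleus is $N(L)=N_\lambda(L)\cap N_\mu(L)\cap N_\rho(L)$ and the center is $\{a\in N(L)\mid ax=xa\ \forall x\in L\}$. Words: let $X=\{x_1,\dots,x_r\}$ be a finite ordered set of letters, and let $P=P(X)$ be the set of all non-associative (fully bracketed) words on $X$, including the empty word $1$, with product given by juxtaposition and $1u=u1=u$. $|v|$ is the number of letters of $v$. Products without brackets are left-normed: $v_1v_2\cdots v_n=(\cdots((v_1v_2)v_3)\cdots)v_n$. $Sub(v)$ is the set of nonempty subwords: $Sub(1)=\emptyset$, $Sub(x)=\{x\}$ for $x\in X$, $Sub(v_1v_2)=\{v_1v_2\}\cup Sub(v_1)\cup Sub(v_2)$ for nonempty $v_1,v_2$. Put $C(X)=\{uu,(uv)v\mid u,v\in P\setminus\{1\}\}$ and $W=W(X)=\{v\in P\mid Sub(v)\cap C(X)=\emptyset\}$ (so $1\in W$). The map $\pi:P\to W$ is defined by induction on length: $\pi(1)=1$; $\pi(x)=x$ for $x\in X$; if $u,v\in W$, then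 $\pi(uv)=1$ if $u=v$, $\pi(uv)=a$ if $u=av$, and $\pi(uv)=uv$ if $uv\in W$; if $u\notin W$ or $v\notin W$, then $\pi(uv)=\pi(\pi(u)\pi(v))$. The sets $R(X)$ and $B(X)$: each nonempty $y\in P$ has a unique decomposition $y=y_1y_2\cdots y_{m-1}y'_m$ (left-normed, nonempty factors) whose first factor is a letter; put $y^t=y'_my_{m-1}\cdots y_1$ and $y^{tt}=(y^t)^t$ (for a letter, $m=1$ and $y^t=y$). Words are ordered by: $x_i>x_j$ if $i>j$; $u>v$ if $|u|>|v|$; if $|u|=|v|\ge 2$, $u=u_1u_2$, $v=v_1v_2$ (nonempty factors), then $u>v$ if $u_2>v_2$, or if $u_2=v_2$ and $u_1>v_1$. For $y\in W\setminus\{1\}$ let $y_0=\min\{y^t,y^{tt}\}$, and let $D=\{y_0\mid y,y_0,y_0^t\in W,\ y_0^t\neq y_0\}$. Put $R_1=X$, $R_n=R_{n-1}\cup\{y\in D\mid |y|\le n,\ y=u_1u_2\cdots u_m \text{ for some } u_1,\dots,u_m\in R_{n-1}\}$ for $n>1$, and $R(X)=\bigcup_n R_n$. Put $B(X)=\{1\}\cup\{y\in W\mid y=y_1y_2\cdots y_n,\ y_i\in R(X)\}$. Multiplication: for every $g\in B(X)\setminus\{1\}$ there are unique $g_1,\dots,g_m\in R(X)$ with $g_i\ne g_{i+1}$ for $i=1,\dots,m-1$ and $g=\pi(g_1g_2\cdots g_mg_{m-1}\cdots g_1)$; put $s(g)=g_1g_2\cdots g_mg_{m-1}\cdots g_1$.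 Define $\circ$ on $B(X)$ by $x\circ1=1\circ x=x$, and, for $y\neq1$ with $s(y)=y_1y_2\cdots y_my_{m-1}\cdots y_1$, $x\circ y=\pi(xy_1y_2\cdots y_my_{m-1}\cdots y_1)$. With this multiplication $B(X)$ is a loop (the free Bol loop of exponent two on $X$) with identity $1$.
   Formalization: The set X is assumed not to have exactly one letter: for one letter x, B(X) = {1, x} with x∘x = 1 is the group of order two, whose nuclei and center are all of B(X), so the claim fails there. *)

(* Defs.v *)
From HB Require Import structures.
From mathcomp Require Import all_boot order.
From mathcomp Require Import boolp classical_sets.

Set Implicit Arguments.
Unset Strict Implicit.
Unset Printing Implicit Defensive.

Local Open Scope classical_set_scope.

(** * Nuclei and center of a loop with carrier [L : set T] and product [op] *)

Section Nuclei.
Variables (T : Type) (L : set T) (op : T -> T -> T).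

Definition left_nucleus : set T :=
  [set a | L a /\ forall x y, L x -> L y -> op a (op x y) = op (op a x) y].

Definition middle_nucleus : set T :=
  [set a | L a /\ forall x y, L x -> L y -> op x (op a y) = op (op x a) y].

Definition right_nucleus : set T :=
  [set a | L a /\ forall x y, L x -> L y -> op x (op y a) = op (op x y) a].

Definition nucleus : set T := left_nucleus `&` middle_nucleus `&` right_nucleus.

Definition loop_center : set T :=
  [set a | nucleus a /\ forall x, L x -> op a x = op x a].

End Nuclei.

(** * Non-associative words *)

(* Nonempty words; [P] adds the empty word as [None]. *)
Inductive nword (X : Type) := Letter of X | Node of nword X & nword X.

Fixpoint nword_encode (X : Type) (t : nword X) : GenTree.tree X :=
  match t with
  | Letter x => GenTree.Leaf x
  | Node u v => GenTree.Node 0 [:: nword_encode u; nword_encode v]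
  end.

Fixpoint nword_decode (X : Type) (t : GenTree.tree X) : option (nword X) :=
  match t with
  | GenTree.Leaf x => Some (Letter x)
  | GenTree.Node _ [:: a; b] =>
      if nword_decode a is Some u then
        if nword_decode b is Some v then Some (Node u v) else None
      else None
  | _ => None
  end.

Lemma nword_encodeK (X : Type) : pcancel (@nword_encode X) (@nword_decode X).
Proof. by elim=> //= u -> v ->. Qed.

HB.instance Definition _ (X : eqType) :=
  Equality.copy (nword X) (pcan_type (@nword_encodeK X)).
HB.instance Definition _ (X : choiceType) :=
  Choice.copy (nword X) (pcan_type (@nword_encodeK X)).

Definition P (X : Type) := option (nword X).

Definition word1 {X : Type} : P X := None.

Section Words.
Variable X : choiceType.
Implicit Types (u v w : nword X) (g : P X).

Definition mulw (a b : P X) : P X :=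
  match a, b with
  | None, _ => b
  | _, None => a
  | Some u, Some v => Some (Node u v)
  end.

(* The left-normed product [(..((v1 v2) v3)..) vn]. *)
Definition lprod (s : seq (P X)) : P X := foldl mulw word1 s.

Fixpoint nlen (u : nword X) : nat :=
  match u with Letter _ => 1 | Node u v => nlen u + nlen v end.

Fixpoint nSub (t : nword X) : seq (nword X) :=
  match t with
  | Letter _ => [:: t]
  | Node u v => t :: nSub u ++ nSub v
  end.

Definition Sub (g : P X) : seq (nword X) := if g is Some t then nSub t else [::].

Definition C (t : nword X) : Prop :=
  (exists u, t = Node u u) \/ (exists u v, t = Node (Node u v) v).

Definition W : set (P X) := [set g | forall t, t \in Sub g -> ~ C t].

(** ** The reduction [P -> W] *)

(* [red a b] is the value of [pi] on the product of two words [a], [b] of [W]. *)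
Definition red (a b : P X) : P X :=
  match a, b with
  | None, _ => b
  | _, None => a
  | Some u, Some v =>
      if u == v then None
      else if u is Node u1 u2 then
        if u2 == v then Some u1 else Some (Node u v)
      else Some (Node u v)
  end.

(* Since [pi] is the identity on [W], its defining clauses amount to structural
   recursion; they are recovered as [pi_word1], [pi_letter], [pi_square],
   [pi_cancel], [pi_id] and [pi_mul] below. *)
Fixpoint npi (t : nword X) : P X :=
  match t with
  | Letter _ => Some t
  | Node u v => red (npi u) (npi v)
  end.

Definition pi (g : P X) : P X := if g is Some t then npi t else word1.

Lemma W_word1 : W word1. Proof. by []. Qed.

Lemma W_letter (x : X) : W (Some (Letter x)).
Proof.
by move=> t; rewrite inE => /eqP -> [[u //]|[u [v //]]].
Qed.

Lemma W_node u v :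
  W (Some (Node u v)) <-> [/\ W (Some u), W (Some v) & ~ C (Node u v)].
Proof.
split=> [H|[Hu Hv Hn] t].
  split=> [t Ht|t Ht|]; apply: H; rewrite /= inE ?mem_cat ?Ht ?orbT //.
  by rewrite eqxx.
rewrite /= inE mem_cat => /orP[/eqP -> //|/orP[]]; [exact: Hu|exact: Hv].
Qed.

Lemma W_red (a b : P X) : W a -> W b -> W (red a b).
Proof.
case: a b => [u|] [v|] //= Wu Wv.
have [//|nuv] := eqVneq u v.
case: u Wu nuv => [x|u1 u2] Wu nuv.
  apply/W_node; split=> // -[[w [e1 e2]]|[w [w' [//]]]].
  by rewrite e1 e2 eqxx in nuv.
have [_|n2] := eqVneq u2 v; first by case/W_node: Wu.
apply/W_node; split=> // -[[w [e1 e2]]|[w [w' [_ e1 e2]]]].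
  by rewrite e1 e2 eqxx in nuv.
by rewrite e1 e2 eqxx in n2.
Qed.

Lemma pi_W g : W (pi g).
Proof.
case: g => [t|] //=; elim: t => [x|u Wu v Wv] /=; first exact: W_letter.
exact: W_red.
Qed.

Lemma pi_id g : W g -> pi g = g.
Proof.
case: g => [t|] //=; elim: t => [//|u IHu v IHv] /= /W_node[Wu Wv nC].
rewrite IHu // IHv //=; case: eqP => [e|_].
  by case: nC; left; exists u; rewrite -e.
case: u nC {Wu IHu} => [//|u1 u2] nC; case: eqP => // e.
by case: nC; right; exists u1, u2; rewrite -e.
Qed.

Lemma pi_mulE (a b : P X) : pi (mulw a b) = red (pi a) (pi b).
Proof. by case: a b => [u|] [v|] //=; case: (npi u). Qed.

Lemma pi_word1 : pi word1 = word1. Proof. by []. Qed.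

Lemma pi_letter (x : X) : pi (Some (Letter x)) = Some (Letter x).
Proof. by []. Qed.

Lemma pi_square g : W g -> pi (mulw g g) = word1.
Proof. by move=> Wg; rewrite pi_mulE pi_id //; case: g {Wg} => //= t; rewrite eqxx. Qed.

Lemma nlen_gt0 u : 0 < nlen u.
Proof. by elim: u => //= u Hu v _; rewrite addn_gt0 Hu. Qed.

Lemma pi_cancel (a v : P X) :
  W (mulw a v) -> W v -> pi (mulw (mulw a v) v) = a.
Proof.
move=> Wav Wv; rewrite pi_mulE (pi_id Wav) (pi_id Wv).
case: a v {Wav Wv} => [u|] [v|] //=; last by rewrite eqxx.
case: eqP => [/(congr1 nlen)/= /eqP|_]; last by rewrite eqxx.
by rewrite -[X in _ == X]add0n eqn_add2r => /eqP e; move: (nlen_gt0 u); rewrite e.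
Qed.

Lemma pi_mul (a b : P X) : pi (mulw a b) = pi (mulw (pi a) (pi b)).
Proof. by rewrite !pi_mulE !(pi_id (@pi_W _)). Qed.

(** ** Reversal *)

(* The factors of [y = y1 y2 .. ym] (left-normed) where [y1] is a letter. *)
Fixpoint factors (y : nword X) : seq (nword X) :=
  match y with
  | Letter _ => [:: y]
  | Node u v => rcons (factors u) v
  end.

(* [factors y] is never empty, so the second branch is not reached. *)
Definition tr (y : nword X) : nword X :=
  if rev (factors y) is v :: s then foldl (@Node X) v s else y.

End Words.

(** * The loop [B(X)] *)

Section BolLoop.
Variables (d : Order.disp_t) (X : finOrderType d).
Implicit Types (u v y : nword X).

Fixpoint wlt (u v : nword X) : bool :=
  (nlen u < nlen v) ||
  (nlen u == nlen v) &&
  match u, v with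
  | Letter x, Letter x' => (x < x')%O
  | Node u1 u2, Node v1 v2 => wlt u2 v2 || (u2 == v2) && wlt u1 v1
  | _, _ => false
  end.

Definition wmin (u v : nword X) : nword X := if wlt u v then u else v.

Definition y0 (y : nword X) : nword X := wmin (tr y) (tr (tr y)).

Definition D : set (nword X) :=
  [set z | exists y, [/\ z = y0 y, W (Some y), W (Some z), W (Some (tr z))
                       & tr z <> z]].

Definition product_of (A : set (nword X)) : set (P X) :=
  [set g | exists us : seq (nword X),
     (forall u, u \in us -> A u) /\ g = lprod [seq Some u | u <- us]].

(* The sequence starts at [n = 1]; the value [set0] at [0] is a filler. *)
Fixpoint Rn (n : nat) : set (nword X) :=
  match n with
  | 0 => set0
  | n'.+1 =>
      if n' is 0 then [set y | exists x, y = Letter x]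
      else Rn n' `|` [set y | [/\ D y, nlen y <= n & product_of (Rn n') (Some y)]]
  end.

Definition R : set (nword X) := \bigcup_n Rn n.

Definition B : set (P X) := [set word1] `|` [set g | W g /\ product_of R g].

(* [g1 .. gm |-> g1 .. gm .. g1] *)
Definition palindrome (s : seq (nword X)) : seq (nword X) := s ++ behead (rev s).

Definition is_sfactors (g : P X) (s : seq (nword X)) : Prop :=
  [/\ forall u, u \in s -> R u, sorted (fun u v => u != v) s
    & g = pi (lprod [seq Some u | u <- palindrome s])].

(* The [g1, .., gm] attached to [g]; for [g] in [B] distinct from [1], the
   sequence satisfying [is_sfactors g] exists and is unique. *)
Definition sfactors (g : P X) : seq (nword X) := xget [::] [set s | is_sfactors g s].

(* For [x = 1] and [y] in [B] distinct from [1], the second clause gives [y],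
   by the choice of [sfactors y]. *)
Definition circ (x y : P X) : P X :=
  if y is None then x
  else pi (lprod (x :: [seq Some u | u <- palindrome (sfactors y)])).

End BolLoop.

Arguments B {d} X.
Arguments R {d} X.
Arguments D {d} X.

(* Main.v *)
Require Import Defs.
From mathcomp Require Import all_boot order zify.
From mathcomp Require Import boolp classical_sets.

(** Each [r] in [R(X)] acts on [B(X)] by the involution [a |-> pi(a r)], and
    [x o y] is the image of [x] under the palindrome [p_y] of such involutions
    that takes [1] to [y].

    Palindromes taking [1] to [y] correspond to paths from the pair [{1, y}] to a
    pair [{a, pi(a r)}] under the diagonal action.  Such a path exists by
    induction on the total length of the pair: factors are moved from one member
    to the other until there is a cancellation, and when there is none the pairs
    met include [{1, y}] and [{1, y^t}], so that either one of [y], [y^t] is in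
    [R(X)] or [y = y^t] is itself a palindrome.

    If [a <> 1] is in the middle (right) nucleus then [p_(a o y) = p_a p_y]
    ([p_(y o a) = p_y p_a]) for all [y].  The left side has odd length unless it
    is empty, the right side has even length, and the parity of the length is
    detected by the action on long words; hence [y = a] for every [y <> 1], which
    is impossible with two letters.

    For the left nucleus take letters [x < y], so that [yx] is in [R(X)] and [xy]
    is not.  The palindromes of [x], [y] and [yx] are unique, since a reduced path
    that once lengthens both members of a pair never reaches a pair
    [{a, pi(a r)}] again.  Hence [a o (y o x) = pi(a (yx))], which differs from
    [(a o y) o x = pi(pi(a y) x)] as soon as [a <> 1]. *)

Set Implicit Arguments.
Unset Strict Implicit.
Unset Printing Implicit Defensive.

Local Open Scope classical_set_scope.

(** * The action of one word on words by reduced right multiplication *)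

Section Action.
Variable X : choiceType.
Implicit Types (u v r : nword X) (a b : P X) (s : seq (nword X)).

Definition act a r : P X := red a (Some r).

Variant act_spec a r : P X -> Prop :=
| ActWord1 of a = None : act_spec a r (Some r)
| ActSquare of a = Some r : act_spec a r None
| ActCancel u of a = Some (Node u r) : act_spec a r (Some u)
| ActNode u of a = Some u & u <> r & (forall w, u <> Node w r) :
    act_spec a r (Some (Node u r)).

Lemma actP a r : act_spec a r (act a r).
Proof.
rewrite /act; case: a => [u|] /=; last exact: ActWord1.
have [->|/eqP nur] := eqVneq u r; first exact: ActSquare.
case: u nur => [x|u w] nur; first exact: ActNode.
have [->|/eqP nwr] := eqVneq w r; first exact: ActCancel.
by apply: ActNode => // w' [_ /nwr].
Qed.

Definition plen a := if a is Some u then nlen u else 0.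

Lemma nlenN_neq u v : u <> Node v u.
Proof. by move=> /(congr1 (@nlen X))/=; have := nlen_gt0 v; lia. Qed.

Lemma act_square r : act (Some r) r = None.
Proof. by rewrite /act /= eqxx. Qed.

Lemma act_cancel u r : act (Some (Node u r)) r = Some u.
Proof.
by rewrite /act /=; case: eqP => [/esym/nlenN_neq //|_]; rewrite eqxx.
Qed.

Lemma act_node u r :
  u <> r -> (forall w, u <> Node w r) -> act (Some u) r = Some (Node u r).
Proof.
by move=> n1 n2; case: (actP (Some u) r) => // [[/n1]|w [/n2]|_ [<-]].
Qed.

(** Since [a] avoids squares and words [(ur)r], cancelling a final [r] leaves a word that neither
    equals [r] nor ends in [r], so a second [r] is appended again. *)
Lemma actK a r : W a -> act (act a r) r = a.
Proof.
case: (actP a r) => [->|->|u ->|u -> _ _] Wa; rewrite ?act_square ?act_cancel //.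
case/W_node: Wa => _ _ nC; apply: act_node => [e|w e]; apply: nC.
  by left; exists r; rewrite e.
by right; exists w, r; rewrite e.
Qed.

Lemma plen_act a r : plen (act a r) = plen a + nlen r \/
  plen a = plen (act a r) + nlen r.
Proof. by case: (actP a r) => [->|->|u ->|u ->] /=; rewrite ?add0n; auto. Qed.

Lemma pi_foldl a s : (forall r, r \in s -> W (Some r)) ->
  Defs.pi (foldl (@mulw X) a [seq Some r | r <- s]) = foldl act (Defs.pi a) s.
Proof.
elim: s a => [//|r s IH] a Ws /=.
rewrite IH => [|r' r's]; last by apply: Ws; rewrite inE r's orbT.
by rewrite pi_mulE (@pi_id _ (Some r)) //; apply: Ws; rewrite inE eqxx.
Qed.

(** * Factor sequences and reversal *)

Definition pfactors a : seq (nword X) := if a is Some u then factors u else [::].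

Lemma factors_foldl u s : factors (foldl (@Node X) u s) = factors u ++ s.
Proof.
by elim: s u => [|v s IH] u /=; rewrite ?cats0 // IH /= cat_rcons.
Qed.

Lemma factorsE u : exists x s, factors u = Letter x :: s /\
  u = foldl (@Node X) (Letter x) s.
Proof.
elim: u => [x|u [x [s [e1 e2]]] v _]; first by exists x, [::].
by exists x, (rcons s v); rewrite /= e1 foldl_rcons -e2.
Qed.

Lemma factors_inj : injective (@factors X).
Proof.
move=> u v; have [x [s [-> ->]]] := factorsE u.
by have [y [t [-> ->]]] := factorsE v => -[-> ->].
Qed.

Lemma foldl_mulw u s :
  foldl (@mulw X) (Some u) [seq Some r | r <- s] = Some (foldl (@Node X) u s).
Proof. by elim: s u => //= v s IH u; rewrite IH. Qed.

Lemma lprod_cons u s :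
  lprod [seq Some r | r <- u :: s] = Some (foldl (@Node X) u s).
Proof. exact: foldl_mulw. Qed.

Lemma lprod_factors u : lprod [seq Some r | r <- factors u] = Some u.
Proof. by have [x [s [-> e]]] := factorsE u; rewrite lprod_cons -e. Qed.

Lemma lprod_rev_factors u :
  lprod [seq Some r | r <- rev (factors u)] = Some (tr u).
Proof.
rewrite /tr; case e: (rev _) => [|v s]; last by rewrite lprod_cons.
have [x [s [e' _]]] := factorsE u.
by move/(congr1 size): e; rewrite size_rev e'.
Qed.

Lemma W_foldl u s : W (Some (foldl (@Node X) u s)) -> W (Some u).
Proof. by elim: s u => //= v s IH u /IH /W_node[]. Qed.

Lemma tr_factors u v s : rev (factors u) = v :: s -> factors (tr u) = factors v ++ s.
Proof. by rewrite /tr => ->; rewrite factors_foldl. Qed.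

Lemma factors_tr u x s : factors u = rcons s (Letter x) ->
  factors (tr u) = rev (factors u).
Proof. by move=> e; rewrite (@tr_factors u (Letter x) (rev s)) e rev_rcons. Qed.

(** The first factor of [u] is a letter, and reversal carries it to the end. *)
Lemma tr_last u : exists x s, factors (tr u) = rcons s (Letter x).
Proof.
have [x [s [e _]]] := factorsE u.
case: (lastP s) e => [|s' v] e.
  by exists x, [::]; rewrite (@factors_tr u x [::]) e.
rewrite (@tr_factors u v (rcons (rev s') (Letter x))).
  by exists x, (factors v ++ rev s'); rewrite rcons_cat.
by rewrite e -rcons_cons rev_rcons rev_cons.
Qed.

(** A last factor that is a letter is not split further when it moves to the front, so here reversal
    just reverses the factor list. *)
Lemma trK u x s : factors u = rcons s (Letter x) -> tr (tr u) = u.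
Proof.
move=> e; apply: factors_inj; have [y [t [e' _]]] := factorsE u.
have er := factors_tr e.
by rewrite (@factors_tr (tr u) y (rev t)) er ?revK // e' rev_cons.
Qed.

Lemma nlen_factors u : nlen u = sumn [seq nlen v | v <- factors u].
Proof.
elim: u => [x|u IHu v _] //=.
by rewrite map_rcons -cats1 sumn_cat /= -IHu addn0.
Qed.

End Action.

Section Loop.
Variables (d : Order.disp_t) (X : finOrderType d).
Implicit Types (u v r t : nword X) (a b : P X) (s : seq (nword X)).

(** * Membership in [R(X)] and [B(X)] read off from factors *)

Lemma Rn_mono m n u : m <= n -> @Rn d X m u -> @Rn d X n u.
Proof.
move/subnK => <-; elim: (n - m) => // k IH /IH; rewrite addSn /=.
by case: (k + m) => [//|n'] Ru; left.
Qed.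

(** In a left-normed product every element but the first is itself a factor; the first splits into
    its own factors, to which the induction applies. *)
Lemma Rn_factors n u : @Rn d X n u -> forall r, r \in factors u -> @Rn d X n r.
Proof.
elim: n u => [//|[|n] IH] u; first by case=> x -> r; rewrite inE => /eqP ->; exists x.
case=> [Ru r /(IH u Ru) Rr|[_ _ [us [Rus eu]]] r ru]; first by left.
suff: @Rn d X n.+1 r by left.
case: us eu Rus => [//|v us]; rewrite lprod_cons => -[eu] Rus.
move: ru; rewrite eu factors_foldl mem_cat => /orP[rv|rus].
  by apply: (IH v) => //; apply: Rus; rewrite inE eqxx.
by apply: Rus; rewrite inE rus orbT.
Qed.

Lemma R_factors u : R X u -> forall r, r \in factors u -> R X r.
Proof. by case=> n _ Ru r ru; exists n => //; apply: Rn_factors Ru _ ru. Qed.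

Lemma R_letter (x : X) : R X (Letter x).
Proof. by exists 1 => //; exists x. Qed.

Lemma R_node_D u v : R X (Node u v) -> D X (Node u v).
Proof.
case=> n _; elim: n => [//|[|n] IH]; first by case.
by case=> [/IH //|[]].
Qed.

(** The finitely many factors lie in a common stage, and a later stage also meets the length bound.
    With [R_node_D] and [R_factors], this describes the elements of [R(X)] other than letters. *)
Lemma D_R u : D X u -> (forall r, r \in factors u -> R X r) -> R X u.
Proof.
move=> Du Ru.
have [n Rnu] : exists n, forall r, r \in factors u -> @Rn d X n r.
  elim: (factors u) Ru => [|r s IH] Rs; first by exists 0.
  have [|n Rn] := IH; first by move=> r' r's; apply: Rs; rewrite inE r's orbT.
  have [|m _ Rm] := Rs r; first by rewrite inE eqxx.
  exists (maxn m n) => r'; rewrite inE => /orP[/eqP ->|/Rn].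
    exact: Rn_mono (leq_maxl _ _) Rm.
  exact: Rn_mono (leq_maxr _ _).
exists (n + nlen u).+2 => //; right; split=> //; first by lia.
exists (factors u); rewrite lprod_factors; split=> // r /Rnu.
by apply: Rn_mono; lia.
Qed.

Lemma R_W u : R X u -> W (Some u).
Proof.
by case: u => [x _|u v /R_node_D[y [_ _]]]; [exact: W_letter|].
Qed.

Lemma R_tr_W u v : R X (Node u v) -> W (Some (tr (Node u v))).
Proof. by case/R_node_D=> y []. Qed.

Lemma R_last u : R X u -> exists x s, factors u = rcons s (Letter x).
Proof.
case: u => [x _|u v /R_node_D[y [-> _ _ _]]]; first by exists x, [::].
by rewrite /y0 /wmin; case: ifP => _ _; apply: tr_last.
Qed.

Lemma R_node_last u v : R X (Node u v) -> exists x, v = Letter x.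
Proof.
by case/R_last=> x [s] /= /rcons_inj [_ ->]; exists x.
Qed.

(** Reversal exchanges [u] and [tr u], so one of them is the minimum [y0 u], and both have the same
    factors up to order. *)
Lemma R_tr u : W (Some u) -> W (Some (tr u)) -> tr u <> u ->
  (exists x s, factors u = rcons s (Letter x)) ->
  (forall r, r \in factors u -> R X r) -> R X u \/ R X (tr u).
Proof.
move=> Wu Wtu ntu [x [s e]] Ru; have trtr := trK e.
have : D X (y0 u) by exists u; rewrite /y0 /wmin trtr; case: ifP => _;
  rewrite ?trtr; split=> //; apply: nesym.
rewrite /y0 /wmin trtr; case: ifP => _ Du; [right|left]; apply: D_R => //.
by move=> r; rewrite (factors_tr e) mem_rev; apply: Ru.
Qed.

Lemma B_factorsP a :
  B X a <-> W a /\ forall r, r \in pfactors a -> R X r.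
Proof.
split=> [[->|[Wa [us [Rus ea]]]]|[Wa Ra]]; first by split=> //; apply: W_word1.
  split=> //; case: us Rus ea => [_ -> //|u us] Rus.
  rewrite lprod_cons => -> r /=; rewrite factors_foldl mem_cat => /orP[ru|rus].
    by apply: R_factors ru; apply: Rus; rewrite inE eqxx.
  by apply: Rus; rewrite inE rus orbT.
case: a Wa Ra => [u|] Wu Ru; last by left.
by right; split=> //; exists (factors u); rewrite lprod_factors.
Qed.

Lemma B_W a : B X a -> W a. Proof. by case/B_factorsP. Qed.

Lemma B_R r : R X r -> B X (Some r).
Proof. by move=> Rr; apply/B_factorsP; split; [exact: R_W|exact: R_factors]. Qed.

Lemma B_word1 : B X word1. Proof. by left. Qed.

Lemma B_node u v : B X (Some (Node u v)) -> B X (Some u) /\ R X v.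
Proof.
case/B_factorsP=> /W_node[Wu Wv _] Ruv; split.
  by apply/B_factorsP; split=> // r ru; apply: Ruv; rewrite /= mem_rcons inE ru orbT.
by apply: Ruv; rewrite /= mem_rcons inE eqxx.
Qed.

Lemma B_act a r : B X a -> R X r -> B X (act a r).
Proof.
move=> Ba Rr; have Wr := R_W Rr; have Wa := B_W Ba.
have := W_red Wa Wr; rewrite -/(act a r).
case: (actP a r) => [_|_|u e|u e _ _] Wu; first exact: B_R.
- exact: B_word1.
- by move: Ba; rewrite e => /B_node[].
apply/B_factorsP; split=> // r'; rewrite /= mem_rcons inE => /orP[/eqP -> //|ru].
by move/B_factorsP: Ba => [_]; rewrite e; apply.
Qed.

(** * Sequences of generators, palindromes and linked pairs *)

Definition acts a s := foldl (@act X) a s.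

Definition Rseq s := forall r, r \in s -> R X r.

Lemma Rseq_cons r s : Rseq (r :: s) -> R X r /\ Rseq s.
Proof.
by move=> H; split=> [|r' r's]; apply: H; rewrite inE ?eqxx ?r's ?orbT.
Qed.

Lemma Rseq_cat s s' : Rseq s -> Rseq s' -> Rseq (s ++ s').
Proof. by move=> H H' r; rewrite mem_cat => /orP[/H|/H']. Qed.

Lemma Rseq_rev s : Rseq s -> Rseq (rev s).
Proof. by move=> H r; rewrite mem_rev => /H. Qed.

Lemma B_acts a s : B X a -> Rseq s -> B X (acts a s).
Proof.
elim: s a => //= r s IH a Ba /Rseq_cons[Rr Rs].
by apply: IH => //; apply: B_act.
Qed.

Lemma acts_rev a s : B X a -> Rseq s -> acts (acts a s) (rev s) = a.
Proof.
elim: s a => // r s IH a Ba /Rseq_cons[Rr Rs].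
have -> : acts a (r :: s) = acts (act a r) s by [].
rewrite rev_cons /acts foldl_rcons -/(acts (act a r) s) -/(acts _ (rev s)).
by rewrite IH ?actK //; [apply: B_W|apply: B_act].
Qed.

Lemma pi_lprod s : Rseq s -> Defs.pi (lprod [seq Some r | r <- s]) = acts None s.
Proof. by move=> Rs; rewrite /lprod pi_foldl // => r /Rs /R_W. Qed.

Lemma acts_factors u : B X (Some u) -> acts None (factors u) = Some u.
Proof.
by case/B_factorsP=> Wu Ru; rewrite -pi_lprod // lprod_factors pi_id.
Qed.

Lemma act_inj a b r : B X a -> B X b -> act a r = act b r -> a = b.
Proof. by move=> /B_W Wa /B_W Wb e; rewrite -(actK r Wa) e actK. Qed.

(* The pair [{a, b}] is transported by all but the last generator of [s] to a
   pair exchanged by the last one. *)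
Fixpoint linked a b s : Prop :=
  match s with
  | [::] => False
  | [:: r] => act a r = b
  | r :: s' => linked (act a r) (act b r) s'
  end.

Lemma linked_cons a b r s :
  s <> [::] -> linked a b (r :: s) = linked (act a r) (act b r) s.
Proof. by case: s. Qed.

Lemma palindrome_cons r s :
  s <> [::] -> palindrome (r :: s) = r :: rcons (palindrome s) r.
Proof.
case: s => // r' s _; rewrite /palindrome rev_cons.
case e: (rev (r' :: s)) => [|v t]; last by rewrite -rcons_cat.
by move/(congr1 size): e; rewrite size_rev.
Qed.

Lemma Rseq_palindrome s : Rseq s -> Rseq (palindrome s).
Proof.
by move=> Rs; apply: Rseq_cat => // u /mem_behead; rewrite mem_rev; apply: Rs.
Qed.

(** Adding [r] at both ends conjugates the palindrome by an involution, which amounts to applying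
    [r] to both members of the pair. *)
Lemma linked_palindrome a b s : B X a -> B X b -> Rseq s -> s <> [::] ->
  linked a b s <-> acts a (palindrome s) = b.
Proof.
elim: s a b => // r s IH a b Ba Bb /Rseq_cons[Rr Rs] _.
case: s IH Rs => [//|r' s] IH Rs.
rewrite linked_cons // palindrome_cons // IH //; try exact: B_act.
have : Rseq (palindrome (r' :: s)) by apply: Rseq_palindrome.
move: (palindrome _) => p Rp; rewrite {2}/acts /= foldl_rcons -/(acts _ _).
have Bp := B_acts (B_act Ba Rr) Rp.
by split=> [->|<-]; rewrite actK //; apply: B_W.
Qed.

Lemma linked_sym a b s : B X a -> B X b -> Rseq s -> linked a b s -> linked b a s.
Proof.
elim: s a b => // r s IH a b Ba Bb /Rseq_cons[Rr Rs].
case: s IH Rs => [_ _ /= <-|r' s IH Rs]; first by rewrite actK //; apply: B_W.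
by rewrite !(linked_cons _ _ r) //; apply: IH => //; apply: B_act.
Qed.

(** Two equal neighbours act trivially on the pair and are dropped. *)
Lemma linked_reduce a b s : B X a -> B X b -> Rseq s -> linked a b s ->
  exists s', [/\ Rseq s', sorted (fun u v => u != v) s' & linked a b s'].
Proof.
elim: s a b => // r s IH a b Ba Bb /[dup] Rrs /Rseq_cons[Rr Rs].
case: s IH Rs Rrs => [_ _ Rrs lr|v s IH Rs Rrs]; first by exists [:: r].
rewrite (linked_cons _ _ r) // => /IH[||//|s']; try exact: B_act.
case: s' => [[]//|v' s' [Rs' srt lnk]].
have [e|nrv] := eqVneq r v'; last first.
  exists (r :: v' :: s'); split=> //=; last by rewrite nrv.
  by move=> u; rewrite inE => /orP[/eqP -> //|/Rs'].
(* If the repeated generator is the last of the path, one copy must stay as the centre of the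
   palindrome: [r r r] acts as [r]. *)
case: s' Rs' srt lnk => [_ _ /=|v'' s' Rs' srt].
  rewrite -e => /(act_inj (B_act Ba Rr) Bb) e'; exists [:: r]; split=> //.
  by move=> u; rewrite inE => /eqP ->.
rewrite linked_cons // -e !actK; try exact: B_W.
exists (v'' :: s'); split=> //; first by case/Rseq_cons: Rs'.
by case/andP: srt.
Qed.

(** * Existence of a path for every pair of distinct elements *)

Definition links a b := exists s, Rseq s /\ linked a b s.

Lemma links_act a r : R X r -> links a (act a r).
Proof. by move=> Rr; exists [:: r]; split=> // u; rewrite inE => /eqP ->. Qed.

Lemma links_step a b r : R X r -> links (act a r) (act b r) -> links a b.
Proof.
move=> Rr [s [Rs lnk]]; exists (r :: s); split.
  by move=> u; rewrite inE => /orP[/eqP -> //|/Rs].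
by rewrite linked_cons //; case: s Rs lnk.
Qed.

Lemma links_acts a b s : Rseq s -> links (acts a s) (acts b s) -> links a b.
Proof.
elim: s a b => // r s IH a b /Rseq_cons[Rr Rs] lnk.
by apply: (links_step Rr); apply: IH.
Qed.

Lemma links_sym a b : B X a -> B X b -> links a b -> links b a.
Proof. by move=> Ba Bb [s [Rs lnk]]; exists s; split=> //; apply: linked_sym. Qed.

Lemma act_up a r : plen (act a r) = plen a + nlen r -> act a r = mulw a (Some r).
Proof.
by case: (actP a r) => [->|->|u ->|u -> _ _] //=; have := nlen_gt0 r; lia.
Qed.

(* Strip [b] of its factors one by one, letting them act on [a]: either some
   cancellation occurs and the total length drops, or [a] absorbs all of them. *)
Lemma links_walk N a b :
  (forall a b, B X a -> B X b -> a <> b -> plen a + plen b < N -> links a b) ->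
  B X a -> B X b -> a <> b -> plen a + plen b <= N ->
  (forall c, c = foldl (@mulw X) a [seq Some r | r <- rev (pfactors b)] ->
     B X c -> plen c <= N -> links c None) ->
  links a b.
Proof.
move=> IH; case: b => [u|] Ba Bb nab leN H; last first.
  by apply: H => //; move: leN; rewrite /= addn0.
elim: u a Ba Bb nab leN H => [x|u IHu v _] a Ba Bb nab leN H.
  have Rx := R_letter x; apply: (links_step Rx); rewrite act_square.
  have Bax := B_act Ba Rx.
  have nax : act a (Letter x) <> None.
    by rewrite -(act_square (Letter x)) => /(act_inj Ba Bb).
  have [up|down] := plen_act a (Letter x).
    by apply: H => //; [rewrite (act_up up)|rewrite up].
  by apply: IH => //; [exact: B_word1|move: leN => /=; rewrite down /=; lia].
have [Bu Rv] := B_node Bb; apply: (links_step Rv); rewrite act_cancel.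
have Bav := B_act Ba Rv.
have nav : act a v <> Some u.
  by rewrite -(act_cancel u v) => /(act_inj Ba Bb).
have := nlen_gt0 v; move: leN => /= leN v_gt0.
have [up|down] := plen_act a v; last by apply: IH => //=; lia.
apply: IHu => // [|c ec]; first by rewrite up /=; lia.
by apply: H; rewrite ec (act_up up) /= rev_rcons.
Qed.

(** The first half of the factor list carries the pair to one exchanged by the middle factor. A list
    of even length cannot occur: its halves would cancel and give the empty word. *)
Lemma links_palindrome u : B X (Some u) -> rev (factors u) = factors u ->
  links None (Some u).
Proof.
move=> Bu; have /= [_ Ru] := (B_factorsP _).1 Bu.
have := acts_factors Bu; move: Ru; move: (factors u) => l Rl eu rl.
set k := (size l)./2; set p := take k l.
have Rp : Rseq p by move=> r /mem_take /Rl.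
have ed : drop (size l - k) l = rev p.
  by have := take_rev k l; rewrite rl /p => ->; rewrite revK.
have ek : size l - k = odd (size l) + k.
  by rewrite -{1}(odd_double_half (size l)) -/k -addnn; lia.
case o: (odd (size l)) ek => ek; last first.
  have : Some u = None; last by [].
  rewrite -eu -(cat_take_drop k l) -/p -[k in drop k]add0n -ek ed.
  by rewrite /acts foldl_cat -!/(acts _ _) acts_rev //; exact: B_word1.
have lt : k < size l by move: ek; rewrite /=; lia.
have el : l = p ++ nth u l k :: rev p.
  by rewrite -ed ek -drop_nth // cat_take_drop.
have Rm : R X (nth u l k) by apply/Rl/mem_nth.
apply: (links_acts Rp); rewrite -eu el /acts foldl_cat /= -!/(acts _ _).
have Bp := B_acts B_word1 Rp.
have := acts_rev (B_act Bp Rm) (Rseq_rev Rp); rewrite revK => ->.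
exact: links_act.
Qed.

Lemma B_links a b : B X a -> B X b -> a <> b -> links a b.
Proof.
move=> Ba Bb nab; have [N] : exists N, plen a + plen b < N by exists (plen a + plen b).+1.
elim: N a b Ba Bb nab => // N IH.
(* Moving all factors of [u] onto the empty word produces [tr u]. *)
have last_letter u : B X (Some u) -> nlen u <= N ->
    (exists x s, factors u = rcons s (Letter x)) -> links None (Some u).
  move=> Bu leN lu; have [Ru|nRu] := pselect (R X u); first exact: links_act.
  apply: (links_walk IH) => // [|c]; first exact: B_word1.
  rewrite -/(lprod _) lprod_rev_factors => -> Btr _.
  have [etr|/eqP ntr] := eqVneq (tr u) u.
    rewrite etr; apply: links_sym => //; first exact: B_word1.
    by apply: links_palindrome => //; have [x [s /factors_tr <-]] := lu; rewrite etr.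
  have /= [Wu Ru] := (B_factorsP _).1 Bu.
  have [//|Rtr] := R_tr Wu (B_W Btr) ntr lu Ru.
  by rewrite -(act_square (tr u)); apply: links_act.
(* For a word [uv] the generator [v] turns the pair into [{u, v}]; moving the factors of [v] onto
   [u] gives a word that ends in the first factor of [v], a letter. *)
have word u : B X (Some u) -> nlen u <= N -> links None (Some u).
  case: u => [x|u v] Buv leN; first by apply: last_letter => //; exists x, [::].
  have [Bu Rv] := B_node Buv; apply: (links_step Rv); rewrite act_cancel.
  have Bv := B_R Rv; apply: links_sym => //.
  apply: (links_walk IH) => // [[euv]|c].
    by case/W_node: (B_W Buv) => _ _ []; left; exists v; rewrite euv.
  rewrite foldl_mulw => -> Bc lec; apply: links_sym => //; first exact: B_word1.
  apply: last_letter => //; rewrite factors_foldl /=.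
  have [x [s [-> _]]] := factorsE v.
  by exists x, (factors u ++ rev s); rewrite rev_cons rcons_cat.
move=> a b Ba Bb nab leN; apply: (links_walk IH) => // c ec Bc lec.
apply: links_sym => //; first exact: B_word1.
case: c ec Bc lec => [u _|]; first exact: word.
case: a {Ba leN} nab => [u|] nab; first by rewrite foldl_mulw.
by case: b {Bb} nab => // v _; rewrite -/(lprod _) lprod_rev_factors.
Qed.

(** * Blocked pairs and the uniqueness of three palindromes *)

(* The pairs met by a reduced path, whose last step is [t], after a step that
   lengthened both members of the pair. *)
Inductive blocked t a b : Prop :=
| BlockedUp u v of a = Some (Node u t) & b = Some (Node v t) & u <> v
| BlockedLeaf v t1 t2 of t = Node t1 t2 & a = None & b = Some (Node v t)
| BlockedFold v r s s' of R X r & s <> [::] & pfactors a ++ s' = factors r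
    & t = head r s' & b = Some v & factors v = s ++ r :: rev s'.

Lemma R_node_node u t1 t2 : ~ R X (Node u (Node t1 t2)).
Proof. by case/R_node_last. Qed.

(** The reversal of [v] would begin with the factors of [r] followed by [r], hence contain the
    square [rr], whereas reversals of elements of [R(X)] stay in [W]. *)
Lemma R_fold v r s : R X v -> factors v = s ++ r :: rev (factors r) -> False.
Proof.
move=> Rv ev; have [x [s1 [er er']]] := factorsE r.
case: v Rv ev => [y _ /(congr1 size)|v1 v2 /R_tr_W Wtr ev].
  by rewrite size_cat /= size_rev er /=; lia.
have e : rev (factors (Node v1 v2)) = Letter x :: s1 ++ r :: rev s.
  by rewrite ev rev_cat rev_cons revK er -cats1 /= -catA.
move: Wtr; rewrite /tr e foldl_cat -er' /= => /W_foldl /W_node[_ _ []].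
by left; exists r.
Qed.

Lemma fold_last v r s s' : s <> [::] -> factors v = s ++ r :: rev s' ->
  exists v', v = Node v' (head r s').
Proof.
case: v => [x|v1 v2] s0 /= ev.
  by move/(congr1 size): ev; rewrite size_cat /=; case: s s0 => //= *; lia.
exists v1; case: s' ev => [|t s'] /=.
  by rewrite cats1 => /rcons_inj[_ ->].
by rewrite rev_cons -rcons_cons -rcons_cat => /rcons_inj[_ ->].
Qed.

Lemma plen_pfactors a : plen a = sumn [seq nlen v | v <- pfactors a].
Proof. by case: a => // u; apply: nlen_factors. Qed.

Lemma fold_plen a v r s s' : s <> [::] -> pfactors a ++ s' = factors r ->
  factors v = s ++ r :: rev s' -> plen a < nlen v.
Proof.
rewrite plen_pfactors (nlen_factors v) => s0 er ->.
rewrite map_cat sumn_cat /= (nlen_factors r) -er map_cat sumn_cat.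
by case: s s0 => // t s _ /=; have := nlen_gt0 t; lia.
Qed.

Lemma act_None r : act (None : P X) r = Some r. Proof. by []. Qed.

Lemma act_node_node u t t' : t <> t' -> Node u t <> t' ->
  act (Some (Node u t)) t' = Some (Node (Node u t) t').
Proof. by move=> n1 n2; apply: act_node => // w [_ /n1]. Qed.

(** This is the fold with [r = t] and [s'] empty. Later steps may strip the factors of [r] from the
    first word, each of them being appended to the second. *)
Lemma blocked_start t u : R X t -> act (Some u) t = Some (Node u t) ->
  blocked t (act None t) (act (Some u) t).
Proof.
move=> Rt ->; apply: (@BlockedFold _ _ _ _ t (factors u) [::]) => //.
- by have [x [s [-> _]]] := factorsE u.
- by rewrite cats0.
- by rewrite /= cats1.
Qed.

(** Since [t'] differs from [t], a word ending in [t] can only grow or, if it equals [t'], vanish.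
    The three kinds of blocked pairs are closed under these moves. *)
Lemma blocked_step t t' a b : R X t' -> t <> t' -> blocked t a b ->
  act a t' <> b /\
  (blocked t' (act a t') (act b t') \/ blocked t' (act b t') (act a t')).
Proof.
move=> Rt' ntt'; case.
- move=> u v -> -> nuv.
  have nuvt : Node u t <> Node v t by case.
  have [eu|/eqP nu] := eqVneq (Node u t) t'.
    have nv : Node v t <> t' by rewrite -eu => -[/esym].
    rewrite [act (Some (Node v t)) t']act_node_node //.
    rewrite [in act (Some (Node u t)) t']eu act_square; split=> //; left.
    exact: (@BlockedLeaf _ _ _ (Node v t) u t).
  have [ev|/eqP nv] := eqVneq (Node v t) t'.
    rewrite [act (Some (Node u t)) t']act_node_node //.
    split; first by case=> _ /esym.
    rewrite [in act (Some (Node v t)) t']ev act_square; right.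
    exact: (@BlockedLeaf _ _ _ (Node u t) v t).
  rewrite !act_node_node //; split; first by case=> _ /esym.
  by left; apply: BlockedUp.
- move=> v t1 t2 et -> ->.
  (* This word ends in [t], which is not a letter, while every element of [R(X)] ends in a
     letter. *)
  have nv : Node v t <> t' by move=> e; move: Rt'; rewrite -e et => /R_node_node.
  split; first by rewrite act_None => -[/esym].
  by left; apply: blocked_start => //; apply: act_node_node.
move=> v r s s' Rr s0 er et -> ev.
have [v' ev'] := fold_last s0 ev; rewrite -et in ev'.
have lt := fold_plen s0 er ev.
(* When [r] has been stripped completely, [R_fold] prevents [t'] from being [v], and a new fold
   starts. *)
case: a er lt => [u|] er lt; last first.
  have nv : v <> t'.
    by move=> e; apply: (@R_fold v r s); rewrite -?er // e.
  split; first by rewrite act_None => -[/esym].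
  by left; apply: blocked_start => //; rewrite ev' act_node_node -?ev'.
have [eu|/eqP nu] := eqVneq u t'.
  have nv : v <> t' by move=> e; move: lt; rewrite /= e eu ltnn.
  rewrite [in act (Some v) _]ev' act_node_node -?ev' // eu act_square; split=> //.
  (* The first word vanishes: a letter was the last factor of [r] left to strip, while a longer [t']
     gives [BlockedLeaf]. *)
  left; case: t' Rt' ntt' eu nv => [x|t1 t2] Rt' ntt' eu nv; last first.
    exact: (@BlockedLeaf _ _ _ v t1 t2).
  apply: (@BlockedFold _ _ _ _ r s (Letter x :: s')) => //.
    by rewrite -er eu.
  by rewrite /= ev rev_cons -rcons_cons -rcons_cat.
have [e|/eqP nv] := eqVneq v t'.
  rewrite [in act (Some v) _]e act_square.
  have -> : act (Some u) t' = Some (Node u t').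
    apply: act_node => // w eu; move: lt; rewrite /= eu e /=; lia.
  split; first by case=> eu; move: ntt'; rewrite ev' in eu; case: eu => _ /esym.
  by right; apply: (@BlockedLeaf _ _ _ u v' t); rewrite -?e ?ev'.
rewrite [in act (Some v) _]ev' act_node_node -?ev' //.
case: (actP (Some u) t') => // [[/nu //]|u' [eu]|_ [<-] _ nw].
  split; first by case=> e; move: lt; rewrite /= eu e /=; lia.
  left; apply: (@BlockedFold _ _ _ _ r s (t' :: s')) => //.
    by rewrite -er eu /= cat_rcons.
  by rewrite /= ev rev_cons -rcons_cons -rcons_cat.
split; first by rewrite ev' => -[_ /esym].
by left; apply: BlockedUp => //; move=> e; move: lt; rewrite /= e ltnn.
Qed.

Lemma blocked_not_linked t a b s : B X a -> B X b -> Rseq s ->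
  path (fun u v => u != v) t s -> blocked t a b -> ~ linked a b s.
Proof.
elim: s t a b => [? ? ? ? ? ? ? ? []|t' s IH t a b Ba Bb /Rseq_cons[Rt' Rs] /=].
case/andP=> /eqP ntt' pth /(blocked_step Rt' ntt')[nab blk].
have Bat := B_act Ba Rt'; have Bbt := B_act Bb Rt'.
case: s IH Rs pth => [//|t'' s IH Rs pth].
case: blk => blk lnk; first exact: (IH t' _ _ Bat Bbt).
by apply: (IH t' _ _ Bbt Bat) => //; apply: linked_sym.
Qed.

(** A first step [r] merely swaps the members of [{1, r}], and the path then continues with another
    generator; so only paths that start differently have to be excluded. *)
Lemma linked_R_uniq r s : R X r -> Rseq s -> sorted (fun u v => u != v) s ->
  (forall t s', t <> r -> Rseq (t :: s') -> path (fun u v => u != v) t s' ->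
     s' <> [::] -> ~ linked (act None t) (act (Some r) t) s') ->
  linked None (Some r) s -> s = [:: r].
Proof.
move=> Rr + + H.
have {}H t s' : t <> r -> Rseq (t :: s') -> path (fun u v => u != v) t s' ->
    ~ linked None (Some r) (t :: s').
  case: s' => [ntr _ _ /= [/ntr] //|t' s' ntr Rs pth].
  by rewrite linked_cons //; apply: H.
case: s => // t s Rs pth lnk.
have [etr|/eqP ntr] := eqVneq t r; last by case: (H _ _ ntr Rs pth lnk).
rewrite {t}etr in Rs pth lnk *.
case: s Rs pth lnk => // t' s Rs pth.
move: pth Rs; rewrite (linked_cons _ _ r) // act_square act_None => /andP[/eqP nrt' pth].
case/Rseq_cons=> _ Rs lnk; case: (H _ _ (nesym nrt') Rs pth).
by apply: linked_sym lnk => //; [exact: B_R|exact: B_word1].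
Qed.

Lemma linked_letter (x : X) s : Rseq s -> sorted (fun u v => u != v) s ->
  linked None (Some (Letter x)) s -> s = [:: Letter x].
Proof.
move=> Rs srt; apply: linked_R_uniq => //; first exact: R_letter.
move=> t s' nt /Rseq_cons[Rt Rs'] pth _.
apply: (@blocked_not_linked t) => //.
- exact: B_act B_word1 _.
- exact: B_act (B_R (R_letter x)) _.
- by apply: blocked_start => //; apply: act_node => //; exact: nesym.
Qed.

(** The only way to avoid lengthening both members is to pass from [{1, yx}] to [{x, y}] by [x] and
    then to [{xy, 1}] by [y]. There the path could end only with the generator [xy], which is not in
    [R(X)]. *)
Lemma linked_pair (x y : X) s :
  R X (Node (Letter y) (Letter x)) -> ~ R X (Node (Letter x) (Letter y)) ->
  Rseq s -> sorted (fun u v => u != v) s ->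
  linked None (Some (Node (Letter y) (Letter x))) s ->
  s = [:: Node (Letter y) (Letter x)].
Proof.
set q := Node _ _ => Rq nR Rs srt.
have Ry := R_letter y; have Rx := R_letter x.
apply: linked_R_uniq => // t s' ntq /Rseq_cons[Rt Rs'] pth s'0.
have BtN := B_act B_word1 Rt; have Btq := B_act (B_R Rq) Rt.
have [et|/eqP ntx] := eqVneq t (Letter x); last first.
  apply: (@blocked_not_linked t) => //; apply: blocked_start => //.
  by apply: act_node_node => //; exact: nesym.
have Bx := B_R Rx; have By := B_R Ry.
rewrite et act_cancel act_None in BtN Btq pth *.
case: s' Rs' pth s'0 => // t' s' /Rseq_cons[Rt' Rs'] /andP[/eqP nxt' pth] _.
case: s' Rs' pth => [_ _|t'' s' Rs' pth].
  by change (act (Some (Letter x)) t' <> Some (Letter y)); rewrite act_node.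
have nyx : Letter y <> Letter x.
  by move=> e; case/W_node: (R_W Rq) => _ _ []; left; exists (Letter x); rewrite e.
rewrite (linked_cons _ _ t') //.
have Bxt' := B_act Bx Rt'; have Byt' := B_act By Rt'.
rewrite [act (Some (Letter x)) t']act_node // in Bxt' *.
have [et'|/eqP nt'y] := eqVneq t' (Letter y); last first.
  have nyt' := nesym nt'y.
  rewrite [act _ t']act_node // in Byt' *.
  apply: (@blocked_not_linked t') => //.
  by apply: BlockedUp => //; exact: nesym.
rewrite et' act_square in Byt' Bxt' pth * => lnk.
have {}lnk := linked_sym Bxt' Byt' Rs' lnk.
case/Rseq_cons: Rs' lnk pth => Rt'' Rs' + /andP[/eqP nyt'' pth].
have nt'' : Node (Letter x) (Letter y) <> t'' by move=> e; rewrite e in nR.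
case: s' Rs' pth => [_ _ [/esym] //|t3 s' Rs' pth].
rewrite (linked_cons _ _ t'') //.
apply: (@blocked_not_linked t'') => //; try exact: B_act.
by apply: blocked_start => //; apply: act_node_node.
Qed.

(** Words of equal length are compared by their second factors first, so [yx] is smaller than its
    reversal [xy]. *)
Lemma R_pair (x y : X) : (x < y)%O ->
  R X (Node (Letter y) (Letter x)) /\ ~ R X (Node (Letter x) (Letter y)).
Proof.
move=> ltxy; have nxy : x <> y by move=> e; rewrite e Order.POrderTheory.ltxx in ltxy.
have Wn (x' y' : X) : x' <> y' -> W (Some (Node (Letter x') (Letter y'))).
  move=> n; apply/W_node; split; [exact: W_letter|exact: W_letter|].
  by case=> [[u [e1 e2]]|[u [v [//]]]]; case: (etrans e1 (esym e2)) => /n.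
have lt : wlt (Node (Letter y) (Letter x)) (Node (Letter x) (Letter y)).
  by rewrite /= ltxy.
split.
  apply: D_R.
    exists (Node (Letter x) (Letter y)); rewrite /y0 /wmin lt.
    by split=> //; [exact: Wn|apply: Wn => /esym|apply: Wn|case].
  by move=> r; rewrite !inE => /orP[] /eqP ->; apply: R_letter.
case/R_node_D => z [ez _ _ _ _].
(* As [tr z] ends in a letter, [tr z] and [tr (tr z)] are reversals of each other, whatever [z]
   is. *)
have [x1 [s1 e1]] := tr_last z.
move: ez; rewrite /y0; set z1 := tr z.
have trz : tr (tr z1) = z1 by apply: trK e1.
rewrite /wmin; case: ifP => [lt1|nlt] e.
  move: lt1; rewrite -e /tr /= Order.POrderTheory.lt_gtF //=; by case: eqP => // -[/esym].
by move: nlt; rewrite -trz -e lt.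
Qed.

(** * The loop multiplication as an action of palindromes *)

Lemma is_sfactorsP u s : B X (Some u) ->
  is_sfactors (Some u) s <->
  [/\ Rseq s, sorted (fun u v => u != v) s & linked None (Some u) s].
Proof.
move=> Bu; split=> [[Rs srt]|[Rs srt lnk]].
  rewrite pi_lprod; last exact: Rseq_palindrome.
  move=> e; split=> //; apply/linked_palindrome => //; first exact: B_word1.
  by move=> s0; rewrite s0 in e.
split=> //; rewrite pi_lprod; last exact: Rseq_palindrome.
apply/esym/linked_palindrome => //; first exact: B_word1.
by move=> s0; rewrite s0 in lnk.
Qed.

(** A reduced path exists by [B_links] and [linked_reduce], so [xget] does not fall back on its
    default value. *)
Lemma sfactorsP u : B X (Some u) -> is_sfactors (Some u) (sfactors (Some u)).
Proof.
move=> Bu; have BN := B_word1.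
have [//|s [Rs lnk]] := B_links BN Bu.
have [s' [Rs' srt lnk']] := linked_reduce BN Bu Rs lnk.
by apply: (@xgetI _ _ _ s'); apply/is_sfactorsP.
Qed.

Definition pal b := if b is Some _ then palindrome (sfactors b) else [::].

Lemma Rseq_pal b : B X b -> Rseq (pal b).
Proof.
by case: b => // u Bu; case: (sfactorsP Bu) => Rs _ _; apply: Rseq_palindrome.
Qed.

Lemma circE a b : B X a -> B X b -> circ a b = acts a (pal b).
Proof.
move=> Ba Bb; have := Rseq_pal Bb; case: b Bb => // u Bu Rp.
rewrite /circ -/(pal (Some u)) /lprod /= pi_foldl => [|r /Rp /R_W //].
by rewrite pi_id //; apply: B_W.
Qed.

Lemma acts_pal b : B X b -> acts None (pal b) = b.
Proof.
case: b => // u Bu; case: (sfactorsP Bu) => Rs _ e.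
by rewrite {2}e pi_lprod //; apply: Rseq_palindrome.
Qed.

Lemma B_circ a b : B X a -> B X b -> B X (circ a b).
Proof. by move=> Ba Bb; rewrite circE //; apply: B_acts => //; apply: Rseq_pal. Qed.

Lemma circ_word1 b : B X b -> circ word1 b = b.
Proof. by move=> Bb; rewrite circE ?acts_pal //; apply: B_word1. Qed.

Lemma rev_palindrome s : rev (palindrome s) = palindrome s.
Proof.
elim: s => // r [|r' s] // IH.
by rewrite palindrome_cons // rev_cons rev_rcons IH rcons_cons.
Qed.

Lemma rev_pal b : rev (pal b) = pal b.
Proof. by case: b => //= u; apply: rev_palindrome. Qed.

(** The palindrome of [b] acts as an involution that exchanges [1] and [b]. *)
Lemma circ_eq_word1 a b : B X a -> B X b -> circ a b = word1 -> a = b.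
Proof.
move=> Ba Bb; rewrite circE // => e.
by rewrite -[a](acts_rev Ba (Rseq_pal Bb)) e rev_pal acts_pal.
Qed.

(** * Parity of palindromes; the middle and right nuclei *)

Lemma odd_pal b : B X b -> odd (size (pal b)) = (b != None).
Proof.
case: b => // u Bu; case: (sfactorsP Bu) => _ _.
rewrite /pal; case: sfactors => // r s _.
by rewrite /palindrome size_cat size_behead size_rev /= addnn odd_double.
Qed.

(* On words too long to be absorbed by [s], each generator adds or removes
   exactly one factor. *)
Lemma odd_size_acts a s : sumn [seq nlen r | r <- s] < plen a ->
  odd (size (pfactors (acts a s))) = odd (size (pfactors a)) (+) odd (size s).
Proof.
elim: s a => [|r s IH] a; first by rewrite addbF.
move=> /= lt; have := nlen_gt0 r => r0.
rewrite -/(acts _ _) IH; last by have := plen_act a r; lia.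
case: (actP a r) lt => [->|->|u ->|u -> _ _] //=; rewrite ?size_rcons; try lia.
Qed.

(** With two letters available, a letter other than the last factor can always be appended without
    cancellation. *)
Lemma long_word (x y : X) n : x <> y -> exists u, B X (Some u) /\ n <= nlen u.
Proof.
move=> nxy; elim: n => [|n [u [Bu le]]].
  by exists (Letter x); split=> //; apply: B_R; apply: R_letter.
have [s [v e]] : exists s v, factors u = rcons s v.
  have [x' [s [-> _]]] := factorsE u.
  by exists (belast (Letter x') s), (last (Letter x') s); rewrite lastI.
have [z nz] : exists z, Letter z <> v.
  have [ev|/eqP nv] := eqVneq (Letter x) v; last by exists x.
  by exists y; rewrite -ev => -[/esym].
exists (Node u (Letter z)); split; last by rewrite /= addn1.
rewrite -act_node.
- by apply: B_act => //; apply: R_letter.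
- move=> eu; apply: nz; move: e; rewrite eu /= -[[:: _]]/(rcons [::] _).
  by case/rcons_inj.
- by move=> w eu; apply: nz; move: e; rewrite eu /= => /rcons_inj[].
Qed.

Lemma eq_acts_odd (x y : X) s s' : x <> y ->
  (forall a, B X a -> acts a s = acts a s') -> odd (size s) = odd (size s').
Proof.
move=> nxy e.
have [u [Bu lt]] := long_word
  (sumn [seq nlen r | r <- s] + sumn [seq nlen r | r <- s']).+1 nxy.
have lt1 : sumn [seq nlen r | r <- s] < plen (Some u) by move: lt => /=; lia.
have lt2 : sumn [seq nlen r | r <- s'] < plen (Some u) by move: lt => /=; lia.
have := odd_size_acts lt1; rewrite e // odd_size_acts //.
by move/addbI.
Qed.

(* If [pal c] acts as the product of [pal a] and [pal b] then it has even length. *)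
Lemma pal_mul_word1 (x y : X) a b c : x <> y -> B X a -> B X b -> B X c ->
  a <> None -> b <> None ->
  (forall z, B X z -> circ z c = circ (circ z a) b) -> c = None.
Proof.
move=> nxy Ba Bb Bc /eqP na /eqP nb e.
have : odd (size (pal c)) = odd (size (pal a ++ pal b)).
  apply: (eq_acts_odd nxy) => z Bz.
  rewrite -circE // e // (circE (B_circ Bz Ba) Bb) circE //.
  by rewrite [RHS]/acts foldl_cat.
rewrite size_cat oddD !odd_pal // na nb /=.
by case: c {Bc e}.
Qed.

Lemma other_letter (x y : X) a : x <> y -> exists z : X, Some (Letter z) <> a.
Proof.
move=> nxy; have [e|/eqP ne] := eqVneq (Some (Letter x)) a; last by exists x.
by exists y; rewrite -e => -[/esym].
Qed.

Lemma middle_nucleus_word1 (x y : X) a : x <> y ->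
  middle_nucleus (B X) (@circ d X) a -> a = None.
Proof.
move=> nxy [Ba aE]; have [//|/eqP na] := eqVneq a None.
have [z nza] := other_letter a nxy; have Bz := B_R (R_letter z).
have Baz := B_circ Ba Bz; case: nza; apply/esym/circ_eq_word1 => //.
by apply: (pal_mul_word1 nxy Ba Bz) => // w Bw; apply: aE.
Qed.

Lemma right_nucleus_word1 (x y : X) a : x <> y ->
  right_nucleus (B X) (@circ d X) a -> a = None.
Proof.
move=> nxy [Ba aE]; have [//|/eqP na] := eqVneq a None.
have [z nza] := other_letter a nxy; have Bz := B_R (R_letter z).
have Bza := B_circ Bz Ba; case: nza; apply/circ_eq_word1 => //.
by apply: (pal_mul_word1 nxy Bz Ba) => // w Bw; apply: aE.
Qed.

(** * The left nucleus *)

Lemma circ_letter a (x : X) : B X a -> circ a (Some (Letter x)) = act a (Letter x).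
Proof.
move=> Ba; have Bx := B_R (R_letter x).
have /(is_sfactorsP _ Bx)[Rs srt lnk] := sfactorsP Bx.
by rewrite circE // /pal (linked_letter Rs srt lnk).
Qed.

Lemma circ_pair a (x y : X) : B X a -> (x < y)%O ->
  circ a (Some (Node (Letter y) (Letter x))) = act a (Node (Letter y) (Letter x)).
Proof.
move=> Ba /R_pair[Rq nR]; have Bq := B_R Rq.
have /(is_sfactorsP _ Bq)[Rs srt lnk] := sfactorsP Bq.
by rewrite circE // /pal (linked_pair Rq nR Rs srt lnk).
Qed.

(** If [a] is [y] or ends in [y], the two sides differ in length. Otherwise the right side is
    [(ay)x], while the left side ends in [yx] or is shorter than [a]. *)
Lemma act_pair_neq a (x y : X) : x <> y -> a <> None ->
  act a (Node (Letter y) (Letter x)) <> act (act a (Letter y)) (Letter x).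
Proof.
move=> nxy na; case: (actP a (Letter y)) => [//|ea|u ea|u ea nu nu'].
- by rewrite ea act_node // act_None.
- rewrite ea act_node; [|by case=> _ /esym|by move=> w []] => e.
  have := plen_act (Some u) (Letter x); rewrite -e /=; lia.
have nuy : Node u (Letter y) <> Letter x by [].
rewrite (act_node nuy) => [|w [_ /esym] //].
case: (actP a (Node (Letter y) (Letter x))) => [//|//|v ev [e]|v ev _ _ //].
by move: ea; rewrite ev e => -[/(congr1 (@nlen X))] /=; lia.
Qed.

Lemma left_nucleus_word1 (x y : X) a : (x < y)%O ->
  left_nucleus (B X) (@circ d X) a -> a = None.
Proof.
move=> ltxy [Ba aE]; have [//|/eqP na] := eqVneq a None.
have nxy : x <> y by move=> e; rewrite e Order.POrderTheory.ltxx in ltxy.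
have By := B_R (R_letter y); have Bx := B_R (R_letter x).
have := aE _ _ By Bx; rewrite (circ_letter _ (B_circ Ba By)) !circ_letter //.
rewrite act_node => [|[/esym] //|//].
by rewrite circ_pair // => /act_pair_neq; case.
Qed.

End Loop.

Theorem corollary5p7 (d : Order.disp_t) (X : finOrderType d) (hX : #|X| != 1) :
  [/\ left_nucleus (B X) (@circ d X) = [set word1],
      middle_nucleus (B X) (@circ d X) = [set word1],
      right_nucleus (B X) (@circ d X) = [set word1],
      nucleus (B X) (@circ d X) = [set word1]
    & loop_center (B X) (@circ d X) = [set word1]].
Proof.
have B1 := B_word1 X.
have L1 : left_nucleus (B X) (@circ d X) word1.
  by split=> // x y Bx By; rewrite !circ_word1 //; apply: B_circ.
have M1 : middle_nucleus (B X) (@circ d X) word1.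
  by split=> // x y Bx By; rewrite circ_word1.
have R1 : right_nucleus (B X) (@circ d X) word1 by [].
have N1 : nucleus (B X) (@circ d X) word1 by [].
have Z1 : loop_center (B X) (@circ d X) word1.
  by split=> // x Bx; rewrite circ_word1.
have [LE ME RE] : [/\ forall a, left_nucleus (B X) (@circ d X) a -> a = word1,
    forall a, middle_nucleus (B X) (@circ d X) a -> a = word1
    & forall a, right_nucleus (B X) (@circ d X) a -> a = word1].
  (* The hypothesis on the cardinality leaves an empty alphabet, where [B(X)] is reduced to [1], or
     at least two letters. *)
  have [x _|X0] := pickP (@predT X); last first.
    have B0 a : B X a -> a = word1.
      by case: a => // u _; have [x _] := factorsE u; have := X0 x.
    by split=> a [/B0].
  have [y nyx] : exists y, y != x.
    apply/existsP; apply: contraR hX => /existsPn /= xE.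
    rewrite (eq_card1 (x := x)) // => y; rewrite !inE.
    by have := xE y; rewrite negbK.
  wlog lt : x y nyx / (x < y)%O.
    move=> H; have [|le] := Order.TotalTheory.ltP x y; first exact: H.
    by apply: (H y x); rewrite ?[_ == y]eq_sym // Order.POrderTheory.lt_neqAle nyx.
  have nxy : x <> y by move/eqP: nyx => /[swap] ->.
  split=> a; first exact: left_nucleus_word1 lt.
    exact: middle_nucleus_word1 nxy.
  exact: right_nucleus_word1 nxy.
split; apply/seteqP; split=> a.
- exact: LE.
- by move=> ->.
- exact: ME.
- by move=> ->.
- exact: RE.
- by move=> ->.
- by case=> [[/LE]].
- by move=> ->.
- by case=> [[[/LE]]].
- by move=> ->.
Qed.
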